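(* Let $u=123765948\in S_9$ (one-line notation) and $\beta=(4,4,4,4,1,0,0,0,0)$. Then $\#\mathsf{GKKoh}(u,\beta)=2$ and $\#\mathrm{PD}(u,\beta)=3$.
   Context: Cells of the $n\times n$ grid $[n]\times[n]$ are indexed in matrix notation: $(i,j)$ is row $i$ (counted from the top), column $j$ (counted from the left). Pipe dreams. A pipe dream is a filling of the triangular grid $\{(i,j)\in[n]\times[n]: i+j\leq n\}$ with crossing tiles (a pipe entering from the top exits at the bottom, a pipe entering from the right exits at the left) and bump tiles (a pipe entering from the top exits at the left, a pipe entering from the right exits at the bottom); half-bump tiles (a pipe entering from the top exits at the left) are placed on the antidiagonal $i+j=n+1$. This gives $n$ pipes running from the top edge to the left edge. The permutation of a pipe dream: label the pipes $1,\dots,n$ along the top edge from left to right, trace them downwards and leftwards, ignoring any crossing between two pipes that have already crossed (treat such crossing tiles as bump tiles); the permutation $w$ is given by reading the labels along the left edge from top to bottom, as $w(1)w(2)\cdots w(n)$. (Equivalently, $w$ is the Demazure (0-Hecke) product of the $s_{i+j-1}$ over the crossing tiles $(i,j)$, read row by row from top to bottom and right to left within each row.) $\mathrm{PD}(w)$ is the set of pipe dreams with permutation $w$; $\mathrm{wt}(P)_i$ is the number of crossing tiles in row $i$ of $P$; $\mathrm{PD}(w,\alpha)=\{P\in\mathrm{PD}(w):\mathrm{wt}(P)=\alpha\}$. Rothe diagram. For $w\in S_n$, $D(w)=\{(i,j)\in[n]^2: i<w^{-1}(j),\ j<w(i)\}$. Grave diagrams and moves. A grave diagram is a pair $E=(B,G)$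 of disjoint subsets of $[n]\times[n]$; cells of $B$ are boxes, cells of $G$ are ghosts, cells of $B\cup G$ are occupied. Its weight is $\mathrm{wt}(E)_i=\#\{j:(i,j)\in B\cup G\}$. (a) Suppose $(i,j)\in B$ is rightmost among all occupied cells in row $i$; let $i'=\max\{r: 1\leq r<i,\ (r,j)\notin B\cup G\}$; assume $i'$ exists and every occupied cell $(r,j)$ with $i'<r\leq i$ is a box. The ordinary Kohnert move at row $i$ is $(B,G)\mapsto((B\setminus\{(i,j)\})\cup\{(i',j)\},G)$. The $K$-Kohnert move at row $i$ is $(B,G)\mapsto((B\setminus\{(i,j)\})\cup\{(i',j)\},G\cup\{(i,j)\})$. (b) Suppose $(i,j)\in G$ is the rightmost occupied cell in row $i$; let $i'=\max\{r: 1\leq r<i,\ (r,j)\notin B\cup G\}$; assume $i'$ exists and every occupied cell $(r,j)$ with $i'<r<i$ is a ghost. The ghost Kohnert move at row $i$ is $(B,G)\mapsto(B,(G\setminus\{(i,j)\})\cup\{(i',j)\})$. The ghost $K$-Kohnert move at row $i$ is $(B,G)\mapsto(B,G\cup\{(i',j)\})$. $\mathsf{GKKoh}(w)$ is the closure of $(D(w),\varnothing)$ under ordinary, $K$-, ghost, and ghost $K$-Kohnert moves, i.e. the set of all grave diagrams obtainable from $(D(w),\varnothing)$ by finite sequences of such moves, and $\mathsf{GKKoh}(w,\alpha)=\{E\in\mathsf{GKKoh}(w):\mathrm{wt}(E)=\alpha\}$. *)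

(* Defs.v *)
From HB Require Import structures.
From mathcomp Require Import all_boot all_fingroup.

Set Implicit Arguments.
Unset Strict Implicit.
Unset Printing Implicit Defensive.

(* Rows, columns and the points permuted by 'S_n are numbered from 0: the cell
   (i, j) of the n x n grid with 1 <= i, j <= n is the pair (i - 1, j - 1).
   Pipe labels and one-line notation keep the values 1, ..., n. *)
Definition cell (n : nat) : finType := ('I_n * 'I_n)%type.

Definition one_line n (w : 'S_n) : seq nat := [seq (val (w i)).+1 | i <- enum 'I_n].

Definition row_wt n (A : {set cell n}) : n.-tuple nat :=
  [tuple #|[set c in A | c.1 == i]| | i < n].

(** Pipe dreams *)

Definition staircase n : {set cell n} := [set c : cell n | c.1.+1 + c.2.+1 <= n].

(* A pipe dream is encoded by the set of its crossing tiles; all other cells of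
   the staircase carry bump tiles. *)
Definition is_pipe_dream n (P : {set cell n}) : bool := P \subset staircase n.

(* Pairs of pipes that have already crossed, each recorded in both orders. *)
Definition crossed := seq (nat * nat).

(* The pipe [a] enters a tile from the top and the pipe [b] from the right; the
   result is (pipe leaving at the bottom, pipe leaving at the left, crossings).
   A crossing tile between pipes that have already crossed acts as a bump. *)
Definition trace_tile (is_cross : bool) (a b : nat) (X : crossed) :
    nat * nat * crossed :=
  if is_cross && ((a, b) \notin X) then (a, b, [:: (a, b), (b, a) & X])
  else (b, a, X).

(* Traces one row from right to left. [tops] lists the pipes entering from the
   top at columns j, j + 1, ...; the last of these columns holds the half-bump.
   The result is (pipe leaving at the left of column j, pipes leaving at the
   bottom at columns j, j + 1, ..., crossings). *)
Fixpoint trace_row (cross : nat -> bool) (j : nat) (tops : seq nat)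
    (X : crossed) : nat * seq nat * crossed :=
  match tops with
  | [::] => (0, [::], X) (* not reached: every row contains a half-bump *)
  | [:: a] => (a, [::], X)
  | a :: tops' =>
      let: (b, bots, X1) := trace_row cross j.+1 tops' X in
      let: (bot, lft, X2) := trace_tile (cross j) a b X1 in
      (lft, bot :: bots, X2)
  end.

(* Tracing the rows in this order meets the tiles along every pipe in the order
   in which the pipe visits them. *)
Fixpoint trace_rows (cross : nat -> nat -> bool) (i m : nat) (tops : seq nat)
    (X : crossed) : seq nat :=
  match m with
  | 0 => [::]
  | m'.+1 =>
      let: (lft, bots, X1) := trace_row (cross i) 0 tops X in
      lft :: trace_rows cross i.+1 m' bots X1
  end.

(* The labels along the left edge, from top to bottom. *)
Definition pd_word n (P : {set cell n}) : seq nat :=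
  trace_rows (fun i j => [exists c in P, (val c.1 == i) && (val c.2 == j)])
    0 n (iota 1 n) [::].

Definition PD n (w : 'S_n) : {set {set cell n}} :=
  [set P | is_pipe_dream P && (pd_word P == one_line w)].

Definition PD_wt n (w : 'S_n) (alpha : n.-tuple nat) : {set {set cell n}} :=
  [set P in PD w | row_wt P == alpha].

(** Grave diagrams *)

Record grave n := Grave {
  grave_pair : {set cell n} * {set cell n};
  grave_disj : [disjoint grave_pair.1 & grave_pair.2] }.

HB.instance Definition _ n := [isSub for @grave_pair n].
HB.instance Definition _ n := [Finite of grave n by <:].

Definition boxes n (E : grave n) : {set cell n} := (grave_pair E).1.
Definition ghosts n (E : grave n) : {set cell n} := (grave_pair E).2.
Definition occ n (E : grave n) : {set cell n} := boxes E :|: ghosts E.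

Definition rothe n (w : 'S_n) : {set cell n} :=
  [set c : cell n | (c.1 < (w^-1)%g c.2) && (c.2 < w c.1)].

Lemma rothe_disj n (w : 'S_n) : [disjoint rothe w & (set0 : {set cell n})].
Proof. by rewrite disjoint_sym disjoints_subset sub0set. Qed.

Definition rothe_grave n (w : 'S_n) : grave n :=
  @Grave n (rothe w, set0) (rothe_disj w).

Section Moves.
Variable n : nat.
Implicit Types (E F : grave n) (i j k r : 'I_n).

Definition rightmost E i j : bool :=
  ((i, j) \in occ E) && [forall j' : 'I_n, ((i, j') \in occ E) ==> (j' <= j)].

(* k is the largest row r < i such that the cell (r, j) is not occupied. *)
Definition landing E i j k : bool :=
  [&& k < i, (k, j) \notin occ E &
      [forall r : 'I_n, ((r < i) && ((r, j) \notin occ E)) ==> (r <= k)]].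

Definition box_movable E i j k : bool :=
  [&& (i, j) \in boxes E, rightmost E i j, landing E i j k &
      [forall r : 'I_n, ((k < r <= i) && ((r, j) \in occ E))
                        ==> ((r, j) \in boxes E)]].

Definition ghost_movable E i j k : bool :=
  [&& (i, j) \in ghosts E, rightmost E i j, landing E i j k &
      [forall r : 'I_n, ((k < r < i) && ((r, j) \in occ E))
                        ==> ((r, j) \in ghosts E)]].

Definition kohnert_move E F : bool :=
  [exists i, exists j, exists k, box_movable E i j k &&
    (grave_pair F == ((k, j) |: (boxes E :\ (i, j)), ghosts E))].

Definition K_kohnert_move E F : bool :=
  [exists i, exists j, exists k, box_movable E i j k &&
    (grave_pair F == ((k, j) |: (boxes E :\ (i, j)), (i, j) |: ghosts E))].

Definition ghost_kohnert_move E F : bool :=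
  [exists i, exists j, exists k, ghost_movable E i j k &&
    (grave_pair F == (boxes E, (k, j) |: (ghosts E :\ (i, j))))].

Definition ghost_K_kohnert_move E F : bool :=
  [exists i, exists j, exists k, ghost_movable E i j k &&
    (grave_pair F == (boxes E, (k, j) |: ghosts E))].

Definition GK_move : rel (grave n) := fun E F =>
  [|| kohnert_move E F, K_kohnert_move E F,
      ghost_kohnert_move E F | ghost_K_kohnert_move E F].

End Moves.

Definition GKKoh n (w : 'S_n) : {set grave n} :=
  [set E | connect (@GK_move n) (rothe_grave w) E].

Definition GKKoh_wt n (w : 'S_n) (alpha : n.-tuple nat) : {set grave n} :=
  [set E in GKKoh w | row_wt (occ E) == alpha].

(** The permutation 123765948 *)

Definition u_word : seq nat := [:: 1; 2; 3; 7; 6; 5; 9; 4; 8].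

Definition u_fun (i : 'I_9) : 'I_9 := inord (nth 0 u_word i).-1.

Lemma u_funS (i : 'I_9) : (val (u_fun i)).+1 = nth 0 u_word i.
Proof.
have /andP[lb ub] : 0 < nth 0 u_word i <= 9.
  have : all (fun x => 0 < x <= 9) u_word by [].
  by move/all_nthP; apply; exact: ltn_ord.
by rewrite /= inordK prednK.
Qed.

Lemma u_fun_inj : injective u_fun.
Proof.
move=> i j /(congr1 (fun k : 'I_9 => (val k).+1)); rewrite !u_funS => /eqP.
by rewrite nth_uniq ?ltn_ord // => /eqP /val_inj.
Qed.

Definition u : 'S_9 := perm u_fun_inj.

Lemma u_one_line : one_line u = [:: 1; 2; 3; 7; 6; 5; 9; 4; 8].
Proof.
rewrite /one_line (eq_map (g := fun i : 'I_9 => nth 0 u_word (val i))).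
  by rewrite (map_comp (nth 0 u_word) val) val_enum_ord.
by move=> i; rewrite permE u_funS.
Qed.

Definition beta : 9.-tuple nat := [tuple 4; 4; 4; 4; 1; 0; 0; 0; 0].

(* Main.v *)
Require Import Defs.
From mathcomp Require Import all_boot all_fingroup.

(** The moves in a column see the columns to its right only through the set of
    rows occupied there. So the columns can be treated from right to left: a
    relation containing the possible evolutions of the columns to the right of
    column [j], as seen from column [j], together with the moves in column [j],
    gives a finite graph; its vertices from which no admissible final column can
    be reached are discarded, and the remaining edges form the relation for the
    next column. The empty columns of the Rothe diagram of [u] stay empty, so the
    weight [beta] forces the four other columns to fill rows 1 to 4 and to leave
    rows 6 to 9. Among the few grave diagrams that survive, two have one occupied
    cell in row 5, and both are reached by explicit sequences of moves.

    The pipe dreams are enumerated row by row, dropping a partial filling as soon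
    as a pipe leaves on the left with the wrong label. *)

Set Implicit Arguments.
Unset Strict Implicit.
Unset Printing Implicit Defensive.

(** * Moves on tables of columns *)

(* [Some true] is a box, [Some false] a ghost and [None] an empty cell; a table
   lists the columns from left to right, each of them from top to bottom. *)
Local Notation column := (seq (option bool)).
Local Notation table := (seq column).

(** All four moves carry the content of row [i] to row [k]. They differ in the trace [b] left in row
    [i]: nothing, or a ghost for the K-versions. *)
Definition slide (c : column) (i k : nat) (b : option bool) : column :=
  set_nth None (set_nth None c k (nth None c i)) i b.

(* At most one row: the landing row of a move only jumps over cells of the same
   kind as the one that moves. *)
Definition landings (c : column) (i : nat) : seq nat :=
  [seq k <- iota 0 i | ~~ isSome (nth None c k) &
     all (fun r => nth None c r == nth None c i) (iota k.+1 (i - k.+1))].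

(* [m] marks the rows that are occupied to the right of [c]. *)
Definition col_moves (m : bitseq) (c : column) : seq column :=
  [seq slide c p.1 p.2 b
     | p <- [seq (i, k) | i <- [seq i <- iota 0 (size c) |
                                  isSome (nth None c i) & ~~ nth false m i],
                          k <- landings c i],
       b <- [:: None; Some false]].

Definition occupied_rows (n : nat) (t : table) : bitseq :=
  mkseq (fun i => has (fun c => isSome (nth None c i)) t) n.

Fixpoint moves (n : nat) (t : table) : seq table :=
  if t is c :: s then
    [seq d :: s | d <- col_moves (occupied_rows n s) c] ++
    [seq c :: s' | s' <- moves n s]
  else [::].

(* Sets with fast membership test. Keys index buckets, so that the soundness
   lemmas do not depend on their injectivity. *)
Section Trie.
Variable X : eqType.

Inductive trie := Leaf | Node of seq X & trie & trie.

Fixpoint lookup (k : bitseq) (t : trie) : seq X :=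
  if t is Node xs l r then
    if k is b :: k' then lookup k' (if b then r else l) else xs
  else [::].

Fixpoint insert (k : bitseq) (x : X) (t : trie) : trie :=
  let: (xs, l, r) := if t is Node xs l r then (xs, l, r) else ([::], Leaf, Leaf) in
  match k with
  | [::] => Node (if x \in xs then xs else x :: xs) l r
  | true :: k' => Node xs l (insert k' x r)
  | false :: k' => Node xs (insert k' x l) r
  end.

Fixpoint elements (t : trie) : seq X :=
  if t is Node xs l r then xs ++ elements l ++ elements r else [::].

(** Turns a check over the finite list [elements t] into a fact about everything that [lookup]
    finds. *)
Lemma mem_lookup k x t : x \in lookup k t -> x \in elements t.
Proof.
elim: t k => [|xs l IHl r IHr] [|[] k] //= xin; rewrite !mem_cat ?xin //.
  by rewrite (IHr _ xin) !orbT.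
by rewrite (IHl _ xin) orbT.
Qed.

Lemma lookup_insert k x t : x \in lookup k (insert k x t).
Proof.
elim: k t => [|[] k IHk] [|xs l r] /=; rewrite ?IHk ?inE ?eqxx //.
by case: ifP; rewrite ?inE ?eqxx.
Qed.

End Trie.
Arguments Leaf {X}.

(** * The graph of one column and its certificate *)

(* What a column sees of a table on its right: the rows occupied there, and the
   adjacent column. The occupied rows alone decide the moves, but they would let
   one spurious final table survive. *)
Definition env := (column * bitseq)%type.
Definition view := (column * env)%type.

Definition column_key (c : column) : bitseq :=
  flatten [seq if o is Some b then [:: true; b] else [:: false] | o <- c].
Definition env_key (e : env) : bitseq := e.2 ++ column_key e.1.
Definition view_key (v : view) : bitseq := column_key v.1 ++ env_key v.2.

Definition env_of (n : nat) (t : table) : env := (head [::] t, occupied_rows n t).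

Definition env_cons (v : view) : env :=
  (v.1, mkseq (fun i => isSome (nth None v.1 i) || nth false v.2.2 i) (size v.2.2)).

Definition next_views (M : trie (env * env)%type) (v : view) : seq view :=
  [seq (d, v.2) | d <- col_moves v.2.2 v.1] ++
  [seq (v.1, e.2) | e <- lookup (env_key v.2) M & e.1 == v.2].

(** The fuel bounds the depth. A vertex is put in front of the list after its descendants, so that
    [foldr] in [add_alive] treats successors first, except along cycles. Nothing is proved about
    this search: [certified] checks its outcome. *)
Fixpoint dfs (next : view -> seq view) (fuel : nat)
    (t : seq (view * seq view) * trie view) (v : view) :
    seq (view * seq view) * trie view :=
  if fuel is f.+1 then
    if v \in lookup (view_key v) t.2 then t else
    let ws := next v in
    let: (vs, t') := foldl (dfs next f) (t.1, insert (view_key v) v t.2) ws in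
    ((v, ws) :: vs, t')
  else t.

Definition in_trie (t : trie view) (v : view) : bool := v \in lookup (view_key v) t.
Definition edge (M : trie (env * env)%type) (e e' : env) : bool :=
  (e, e') \in lookup (env_key e) M.

(* Row 5, of index 4, is left unconstrained. *)
Definition has_shape (full : bool) (c : column) : bool :=
  all (fun i => isSome (nth None c i) == full) (iota 0 4) &&
  all (fun i => ~~ isSome (nth None c i)) (iota 5 4).

Section Layer.
Variables (n : nat) (full : bool) (M : trie (env * env)%type) (fin : seq table).

Definition goal (v : view) : bool :=
  has_shape full v.1 && has (fun s => env_of n s == v.2) fin.

Definition alive (A : trie view) (v : view) (ws : seq view) : bool :=
  goal v || has (in_trie A) ws.

Definition add_alive (vs : seq (view * seq view)) (A : trie view) : trie view :=
  foldr (fun v A => if alive A v.1 v.2 then insert (view_key v.1) v.1 A else A) A vs.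

(* The graph has a few cycles, hence several passes; [certified] checks that a
   fixed point is reached. *)
Definition alive_trie (vs : seq (view * seq view)) : trie view :=
  iter 3 (add_alive vs) Leaf.

Definition env_edges (A : trie view) : seq (env * env) :=
  flatten [seq [seq (env_cons v, env_cons w) | w <- next_views M v & in_trie A w]
          | v <- elements A].

Definition edge_trie (es : seq (env * env)) : trie (env * env)%type :=
  foldr (fun e => insert (env_key e.1) e) Leaf es.

Definition extend_tails (A : trie view) : seq table :=
  [seq v.1 :: s | v <- [seq v <- elements A | goal v],
                  s <- [seq s <- fin | env_of n s == v.2]].

(** All that soundness relies on: [V] contains the start and is closed under successors, within [V]
    the set [A] contains the goals and every vertex with a successor in [A], and [M'] contains the
    listed edges. Minimality of these sets is not claimed. *)
Definition certified (v0 : view) (V A : trie view) (es : seq (env * env)) M' : bool :=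
  [&& in_trie V v0,
      all (fun v => let ws := next_views M v in
             all (in_trie V) ws && (alive A v ws ==> in_trie A v)) (elements V) &
      all (fun e => edge M' e.1 e.2) es].

Definition layer (v0 : view) : option (trie (env * env)%type * seq table) :=
  let: (vs, V) := dfs (next_views M) 100 ([::], Leaf) v0 in
  let A := alive_trie vs in
  let es := env_edges A in
  let M' := edge_trie es in
  if certified v0 V A es M' then Some (M', extend_tails A) else None.

End Layer.

Fixpoint explore (n : nat) (fs : bitseq) (t : table) :
    option (trie (env * env)%type * seq table) :=
  match fs, t with
  | [::], [::] => let e := env_of n [::] in
      (* The loop stands for the moves made further left, during which the empty tail stays as it
         is. *)
      Some (insert (env_key e) (e, e) Leaf, [:: [::] : table])
  | f :: fs', c :: s =>
      if explore n fs' s is Some (M, fin) then layer n f M fin (c, env_of n s) else None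
  | _, _ => None
  end.

(** * Soundness of the search over columns *)

Definition step (n : nat) (t t' : table) : bool := (t' == t) || (t' \in moves n t).

(** The invariant of the induction over columns. It only concerns paths ending in the prescribed
    shapes, so [M] may drop the edges into dead ends; spurious edges in [M] do no harm. *)
Definition sound n fs t0 (M : trie (env * env)%type) (fin : seq table) : Prop :=
  forall p, path (step n) t0 p -> all2 has_shape fs (last t0 p) ->
  path (edge M) (env_of n t0) (map (env_of n) p) /\ last t0 p \in fin.

Definition view_of n (t : table) : view := (head [::] t, env_of n (behead t)).

Lemma env_cons_view n t : env_cons (view_of n t) = env_of n t.
Proof.
rewrite /env_cons /env_of /= size_mkseq; congr (_, _).
apply/eq_in_map => i; rewrite mem_iota => /= lt_in; rewrite nth_mkseq //.
by case: t => [|c s]; rewrite ?nth_nil.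
Qed.

Lemma step_cons n c s t' :
  step n (c :: s) t' -> exists d s',
  [/\ t' = d :: s', step n s s' &
      (d = c) \/ (s' = s /\ d \in col_moves (occupied_rows n s) c)].
Proof.
case/predU1P => [->|]; first by exists c, s; rewrite /step eqxx; split=> //; left.
rewrite /= mem_cat => /orP[/mapP[d dP ->]|/mapP[s' s'P ->]].
  by exists d, s; rewrite /step eqxx; split=> //; right.
by exists c, s'; rewrite /step s'P orbT; split=> //; left.
Qed.

(** A move in the head column leaves the tail unchanged; as [step] allows stuttering, the tails
    still form a path. *)
Lemma path_behead n c s p :
  path (step n) (c :: s) p -> path (step n) s (map behead p).
Proof.
elim: p c s => //= t p IHp c s /andP[/step_cons[d [s' [-> /= -> _]]]].
exact: IHp.
Qed.

Lemma path_last_cons n c s p :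
  path (step n) (c :: s) p -> exists d s', last (c :: s) p = d :: s'.
Proof.
elim: p c s => [|t p IHp] c s /=; first by exists c, s.
by case/andP=> /step_cons[d [s' [-> _ _]]]; apply: IHp.
Qed.

Lemma path_views n c s p M :
  path (step n) (c :: s) p ->
  path (edge M) (env_of n s) (map (env_of n) (map behead p)) ->
  path (fun v w => w \in next_views M v) (view_of n (c :: s)) (map (view_of n) p).
Proof.
elim: p c s => //= t p IHp c s /andP[/step_cons[d [s' [-> /= _ dP]]] pP].
case/andP=> sM pM; rewrite (IHp d s') // andbT mem_cat.
case: dP => [->|[-> dP]]; last by rewrite (map_f (fun d => (d, _)) dP).
apply/orP; right; apply/mapP; exists (env_of n s, env_of n s') => //.
by rewrite mem_filter eqxx.
Qed.

Section Trim.
Variables (next : view -> seq view) (goal : pred view) (V A : trie view).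
Hypothesis SP : forall v, in_trie V v -> all (in_trie V) (next v).
Hypothesis AP : forall v, in_trie V v -> goal v || has (in_trie A) (next v) -> in_trie A v.

(** Membership in [V] propagates forwards from the start, membership in [A] backwards from the goal.
    Trimming the graph to [A] therefore loses no path that ends in a goal. *)
Lemma path_trim v p :
  in_trie V v -> path (fun v w => w \in next v) v p -> goal (last v p) ->
  in_trie A v /\ path (fun v w => [&& w \in next v, in_trie A v & in_trie A w]) v p.
Proof.
elim: p v => [|w p IHp] v vS /=; first by move=> _ vG; split; rewrite ?AP ?vG.
case/andP=> wv wp wG; have [|wA ->] // := IHp w _ wp wG.
  exact: (allP (SP vS)).
suff vA: in_trie A v by rewrite wv wA vA.
by apply: AP => //; apply/orP; right; apply/hasP; exists w.
Qed.

End Trim.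

Lemma layer_sound n f fs c s M fin M' fin' :
  sound n fs s M fin -> layer n f M fin (c, env_of n s) = Some (M', fin') ->
  sound n (f :: fs) (c :: s) M' fin'.
Proof.
(* The way in which the tries were computed is forgotten; only the certificate is kept. *)
move=> Msound; rewrite /layer; case: (dfs _ _ _ _) => vs V.
move: (alive_trie _ _ _ _) => A; move: (edge_trie _) => E.
case: ifP => // /and3P[v0V /allP VP /allP EP] [<- <-] p pP.
have pbP := path_behead pP.
have [d [s' lastp]] := path_last_cons pP; rewrite lastp /= => /andP[df s'f].
have lasts : last s (map behead p) = s'.
  by rewrite -[s]/(behead (c :: s)) last_map lastp.
have [|pM s'fin] := Msound _ pbP; first by rewrite lasts.
rewrite lasts in s'fin.
have pV := path_views pP pM.
have lastV : last (view_of n (c :: s)) (map (view_of n) p) = (d, env_of n s').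
  by rewrite last_map lastp.
have goalV : goal n f fin (last (view_of n (c :: s)) (map (view_of n) p)).
  by rewrite lastV /goal /= df; apply/hasP; exists s'.
have Vclosed v : in_trie V v -> all (in_trie V) (next_views M v).
  by move/mem_lookup/VP => /andP[].
have Aclosed v : in_trie V v -> alive n f fin A v (next_views M v) -> in_trie A v.
  by move/mem_lookup/VP => /andP[_ /implyP].
have [v0A pA] := path_trim Vclosed Aclosed v0V pV goalV.
have lastA : in_trie A (d, env_of n s').
  rewrite -lastV; case/lastP: {goalV lastV pV} (map _ p) pA => // q w.
  by rewrite rcons_path last_rcons => /and4P[].
split; last first.
  apply/allpairsPdep; exists (d, env_of n s'), s'.
  split=> //; first by rewrite mem_filter (mem_lookup lastA) andbT -lastV.
    by rewrite mem_filter eqxx.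
(* The environments along the path are the images under [env_cons] of its views, so trimmed edges
   become edges of the new relation. *)
rewrite -env_cons_view -(eq_map (env_cons_view n)) map_comp path_map.
apply: sub_path pA => v w /and3P[wv vA wA].
apply: (EP (_, _)); apply/flatten_mapP; exists v; first exact: mem_lookup vA.
by apply: map_f; rewrite mem_filter wA.
Qed.

Lemma explore_sound n fs t M fin : explore n fs t = Some (M, fin) -> sound n fs t M fin.
Proof.
elim: fs t M fin => [|f fs IHfs] [|c s] //= M fin.
  case=> <- <- p; elim: p => [|t p IHp] /=; first by [].
  case/andP=> /predU1P[-> /IHp{}IHp /IHp[-> ->]|//]; split=> //.
  by rewrite /edge lookup_insert.
case Es: explore => [[M' fin']|] //; exact/layer_sound/IHfs.
Qed.

Lemma explore_last n fs t (P : pred table) :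
  (if explore n fs t is Some (_, fin) then all P fin else false) ->
  forall p, path (step n) t p -> all2 has_shape fs (last t p) -> P (last t p).
Proof.
case Et: explore => [[M fin]|] // /allP finP p tp lastp.
by have [_ /finP] := explore_sound Et tp lastp.
Qed.


(** * Cell statuses, and the four moves as one *)

Section Graves.
Variable n : nat.
Implicit Types (E F : grave n) (i j k r : 'I_n) (c : cell n).

Definition status E c : option bool :=
  if c \in boxes E then Some true else if c \in ghosts E then Some false else None.

Lemma boxes_ghosts E c : c \in boxes E -> c \in ghosts E = false.
Proof. by move=> cB; apply: (disjointFr (grave_disj E)). Qed.

Lemma status_box E c : (status E c == Some true) = (c \in boxes E).
Proof. by rewrite /status; case: ifP => // _; case: ifP. Qed.

Lemma status_ghost E c : (status E c == Some false) = (c \in ghosts E).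
Proof. by rewrite /status; case: ifP => [/boxes_ghosts->|_] //; case: ifP. Qed.

Lemma status_occ E c : isSome (status E c) = (c \in occ E).
Proof. by rewrite /status inE; case: ifP => // _; case: ifP. Qed.

Lemma status_inj E F : status E =1 status F -> E = F.
Proof.
move=> eqEF; apply/val_inj/eqP; rewrite /= [grave_pair E]surjective_pairing.
rewrite [grave_pair F]surjective_pairing; apply/eqP; congr (_, _); apply/setP => c.
  by rewrite -[LHS]status_box eqEF status_box.
by rewrite -[LHS]status_ghost eqEF status_ghost.
Qed.

Lemma grave_of_disj (f : cell n -> option bool) :
  [disjoint [set c | f c == Some true] & [set c | f c == Some false]].
Proof.
by rewrite disjoint_subset; apply/subsetP => c; rewrite !inE => /eqP->.
Qed.

Definition grave_of f : grave n := Grave (grave_pair := (_, _)) (grave_of_disj f).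

Lemma status_grave_of f c : status (grave_of f) c = f c.
Proof. by rewrite /status !inE /=; case: (f c) => [[]|]. Qed.

Definition slidable E i j k : bool :=
  [&& k < i, isSome (status E (i, j)), ~~ isSome (status E (k, j)),
      [forall r : 'I_n, (k < r < i) ==> (status E (r, j) == status E (i, j))] &
      [forall j' : 'I_n, (j < j') ==> ~~ isSome (status E (i, j'))]].

Lemma rightmostE E i j :
  rightmost E i j =
  isSome (status E (i, j)) && [forall j' : 'I_n, (j < j') ==> ~~ isSome (status E (i, j'))].
Proof.
rewrite /rightmost status_occ; congr (_ && _); apply: eq_forallb => j'.
by rewrite status_occ ltnNge; case: (_ \in _); case: (_ <= _).
Qed.

(** By maximality of [k], every cell strictly between rows [k] and [i] is occupied, hence has status
    [Some b]. Conversely, cells of that status are occupied, which makes [k] maximal. *)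
Lemma landing_slidable b E i j k :
  [&& status E (i, j) == Some b, rightmost E i j, landing E i j k &
      [forall r : 'I_n, ((k < r < i) && ((r, j) \in occ E))
                        ==> (status E (r, j) == Some b)]] =
  slidable E i j k && (status E (i, j) == Some b).
Proof.
rewrite rightmostE /landing /slidable; case: eqP => [-> | _]; last by rewrite andbF.
rewrite status_occ /= andbT; case: (k < i) => //=; last by rewrite andbF.
case: ((k, j) \notin _) => /=; last by rewrite andbF.
case: [forall j' : 'I_n, _] => /=; last by rewrite andbF.
rewrite andbT; apply/andP/forallP => [[/forallP lP /forallP bP] r|sP].
  apply/implyP => /andP[kr ri]; apply: (implyP (bP r)); rewrite kr ri /=.
  by apply: contraLR kr => rN; rewrite -leqNgt; apply: (implyP (lP r)); rewrite ri.
split; apply/forallP => r; apply/implyP; last first.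
  by case/andP=> kri _; apply: (implyP (sP r)).
case/andP=> ri; rewrite leqNgt; apply: contra => kr.
by rewrite -status_occ (eqP (implyP (sP r) _)) ?kr.
Qed.

Lemma box_movableE E i j k :
  box_movable E i j k = slidable E i j k && (status E (i, j) == Some true).
Proof.
rewrite -landing_slidable status_box /box_movable.
case ijB: (_ \in boxes E) => //=; do 2![congr (_ && _)]; apply: eq_forallb => r.
(* The condition for boxes also ranges over [r = i], where it holds because [(i, j)] is a box. *)
rewrite status_box [r <= i]leq_eqVlt; case: eqP => [/val_inj->|] //=.
by rewrite ijB ltnn !implybT.
Qed.

Lemma ghost_movableE E i j k :
  ghost_movable E i j k = slidable E i j k && (status E (i, j) == Some false).
Proof.
rewrite -landing_slidable status_ghost /ghost_movable.
by under [X in _ = [&& _, _, _ & X]]eq_forallb => r do rewrite status_ghost.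
Qed.

Definition moved E i j k (b : option bool) : grave n :=
  grave_of (fun c => if c == (i, j) then b else
    if c == (k, j) then status E (i, j) else status E c).

Lemma grave_pair_moved E i j k b :
  slidable E i j k -> b \in [:: None; Some false] ->
  grave_pair (moved E i j k b) =
    if status E (i, j) == Some true then
      ((k, j) |: (boxes E :\ (i, j)), if b then (i, j) |: ghosts E else ghosts E)
    else (boxes E, (k, j) |: (if b then ghosts E else ghosts E :\ (i, j))).
Proof.
case/and3P=> ki ijE /andP[kjE _] bP.
have ikE : ((i, j) == (k, j)) = false.
  by apply/eqP => -[eq_ik]; rewrite eq_ik ltnn in ki.
have nb : b == Some true = false by move: bP; rewrite !inE => /pred2P[]->.
have bE : b == Some false = b by move: bP; rewrite !inE => /pred2P[]->.
have [] : status E (i, j) = Some true \/ status E (i, j) = Some false.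
- by case: (status E (i, j)) ijE => [[]|] //; [left | right].
- move=> ijS; have ijB : (i, j) \in boxes E by rewrite -status_box ijS.
  rewrite ijS eqxx; congr (_, _); apply/setP => c; rewrite !inE;
    have [->|cij] := eqVneq c (i, j); rewrite ?ikE ?nb ?bE //=.
  + by rewrite ijS; case: (c =P _) => //= _; rewrite status_box.
  + by case: (isSome b); rewrite ?inE ?eqxx ?boxes_ghosts.
  case: (c =P _) => [->|_].
    rewrite ijS; case: (isSome b); rewrite ?inE ?[(k, _) == _]eq_sym ?ikE -status_ghost;
      by case: (status E (k, j)) kjE.
  by rewrite status_ghost; case: (isSome b); rewrite ?inE // (negPf cij).
move=> ijS; have ijB : (i, j) \in ghosts E by rewrite -status_ghost ijS.
rewrite ijS; congr (_, _); apply/setP => c; rewrite !inE;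
  have [->|cij] := eqVneq c (i, j); rewrite ?ikE ?nb ?bE //=.
- by apply/esym/negbTE; rewrite -status_box ijS.
- rewrite ijS; case: (c =P _) => [->|_]; last by rewrite status_box.
  by rewrite -status_box; case: (status E (k, j)) kjE.
- by case: (isSome b); rewrite ?inE ?eqxx.
case: (c =P _) => [->|_] /=; first by rewrite ijS.
by rewrite status_ghost; case: (isSome b); rewrite ?inE // cij.
Qed.

(** The status of [(i, j)] separates box moves from ghost moves, and [b] separates the ordinary ones
    from the K-versions. *)
Lemma GK_moveP E F :
  reflect (exists i j k b,
             [/\ slidable E i j k, b \in [:: None; Some false] & F = moved E i j k b])
          (GK_move E F).
Proof.
have FE P : grave_pair F = grave_pair P -> F = P by exact: val_inj.
apply: (iffP idP) => [|[i [j [k [b [sP bP FP]]]]]].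
  case/or4P=> /existsP[i /existsP[j /existsP[k]]];
    rewrite ?box_movableE ?ghost_movableE => /andP[/andP[sP ijS] /eqP FP];
    exists i, j, k.
  - by exists None; split=> //; apply: FE; rewrite grave_pair_moved // ijS.
  - by exists (Some false); split=> //; apply: FE; rewrite grave_pair_moved // ijS.
  - by exists None; split=> //; apply: FE; rewrite grave_pair_moved // (eqP ijS).
  by exists (Some false); split=> //; apply: FE; rewrite grave_pair_moved // (eqP ijS).
have [_ ijE _ _ _] := and5P sP.
have ijP : (status E (i, j) == Some true) || (status E (i, j) == Some false).
  by case: (status _ _) ijE => [[]|].
have := grave_pair_moved sP bP; rewrite -FP => FP'.
rewrite /GK_move; case/orP: ijP => ijS; rewrite ?ijS ?(eqP ijS) /= in FP';
  move: bP FP'; rewrite !inE => /pred2P[] -> FP';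
  apply/or4P; [apply: Or41 | apply: Or42 | apply: Or43 | apply: Or44];
  apply/existsP; exists i; apply/existsP; exists j; apply/existsP; exists k;
  by rewrite ?box_movableE ?ghost_movableE sP ?ijS FP' /=.
Qed.

End Graves.

(** * Grave diagrams as tables *)

Lemma col_movesP m c d :
  reflect (exists i k b,
     [/\ k < i < size c, isSome (nth None c i) && ~~ nth false m i, ~~ isSome (nth None c k),
         forall r, k < r < i -> nth None c r = nth None c i
       & b \in [:: None; Some false] /\ d = slide c i k b])
    (d \in col_moves m c).
Proof.
apply: (iffP allpairsP).
  case=> [[p b] /= [/allpairsPdep[i [k [iP kP ->]]] bP ->]]; exists i, k, b.
  move: iP kP; rewrite !mem_filter !mem_iota !add0n /= => /andP[-> ->].
  case/andP=> /andP[-> /allP eqP_] ->; split=> // r /andP[kr ri].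
  by apply/eqP/eqP_; rewrite mem_iota kr subnKC // (ltn_trans kr).
case=> i [k [b [/andP[ki ic] iP kP eqP_ [bP ->]]]]; exists ((i, k), b); split=> //.
apply/allpairsPdep; exists i, k; split=> //; first by rewrite mem_filter iP mem_iota.
rewrite mem_filter mem_iota kP ki !andbT; apply/allP => r.
by rewrite mem_iota subnKC // => kr; apply/eqP/eqP_.
Qed.

Lemma movesP n t t' :
  reflect (exists j d,
     [/\ j < size t, d \in col_moves (occupied_rows n (drop j.+1 t)) (nth [::] t j)
       & t' = set_nth [::] t j d])
    (t' \in moves n t).
Proof.
elim: t t' => [|c s IHs] t' /=; first by apply: (iffP idP) => // -[j [d []]].
rewrite mem_cat; apply: (iffP orP) => [[/mapP[d dP ->]|/mapP[s' /IHs[j [d [js dP ->]]] ->]]|].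
- by exists 0, d; rewrite drop0.
- by exists j.+1, d.
case=> [[|j] [d [js dP ->]]]; first by left; apply: map_f; rewrite drop0 in dP.
by right; apply: map_f; apply/IHs; exists j, d.
Qed.

(** Moves stay within a column, and an empty column has no cell to move. *)
Lemma step_empty_column n t t' j :
  step n t t' -> ~~ has isSome (nth [::] t j) -> nth [::] t' j = nth [::] t j.
Proof.
case/predU1P => [->//|/movesP[j' [d [_ dP ->]]] tj]; rewrite nth_set_nth /=.
case: eqP => // jj'; case/col_movesP: dP => i [k [b [/andP[_ ic] /andP[iS _] _ _ _]]].
case/hasP: tj; exists (nth None (nth [::] t j') i) => //.
by rewrite jj' mem_nth.
Qed.

Lemma path_empty_column n t p j :
  path (step n) t p -> ~~ has isSome (nth [::] t j) ->
  nth [::] (last t p) j = nth [::] t j.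
Proof.
elim: p t => //= t' p IHp t /andP[tt' t'p] tj.
by have tj' := step_empty_column tt' tj; rewrite IHp ?tj'.
Qed.

Section Tables.
Variable n : nat.
Implicit Types (E F : grave n) (i j k r : 'I_n).

Definition table_of E : table :=
  [seq [seq status E (i, j) | i <- enum 'I_n] | j <- enum 'I_n].

Lemma size_table_of E : size (table_of E) = n.
Proof. by rewrite size_map size_enum_ord. Qed.

Lemma size_column E j : size (nth [::] (table_of E) j) = n.
Proof. by rewrite (nth_map j) ?size_enum_ord // size_map size_enum_ord. Qed.

Lemma nth_table_of E i j : nth None (nth [::] (table_of E) j) i = status E (i, j).
Proof.
by rewrite (nth_map j) ?size_enum_ord // (nth_map i) ?size_enum_ord // !nth_ord_enum.
Qed.

Lemma table_of_inj : injective table_of.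
Proof. by move=> E F eqEF; apply: status_inj => -[i j]; rewrite -!nth_table_of eqEF. Qed.

Lemma nth_occupied_rows E i j :
  nth false (occupied_rows n (drop j.+1 (table_of E))) i =
  [exists j' : 'I_n, (j < j') && isSome (status E (i, j'))].
Proof.
rewrite nth_mkseq //; apply/(has_nthP [::])/existsP => [[l]|[j' /andP[jj' j'S]]].
  rewrite size_drop size_table_of nth_drop ltn_subRL => ltl lS.
  by exists (Ordinal ltl); rewrite -nth_table_of lS andbT /= leq_addr.
exists (j' - j.+1); first by rewrite size_drop size_table_of ltn_sub2r // (leq_ltn_trans jj').
by rewrite nth_drop subnKC // nth_table_of.
Qed.

Lemma table_of_moved E i j k b :
  slidable E i j k ->
  table_of (moved E i j k b) =
  set_nth [::] (table_of E) j (slide (nth [::] (table_of E) j) i k b).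
Proof.
case/andP=> ki _; apply: (@eq_from_nth _ [::]).
  by rewrite size_set_nth !size_table_of (maxn_idPr _).
move=> j1; rewrite size_table_of => j1n; rewrite nth_set_nth /=.
rewrite -[j1]/(nat_of_ord (Ordinal j1n)); move: (Ordinal j1n) => j' {j1 j1n}.
apply: (@eq_from_nth _ None).
  rewrite size_column; case: eqP => [_|_]; last by rewrite size_column.
  by rewrite !size_set_nth !size_column !(maxn_idPr _) // (maxn_idPr _).
move=> i1; rewrite size_column => i1n.
rewrite -[i1]/(nat_of_ord (Ordinal i1n)); move: (Ordinal i1n) => i' {i1 i1n}.
rewrite nth_table_of status_grave_of !xpair_eqE.
rewrite [nat_of_ord j' == _](_ : _ = (j' == j)) //.
have [->|_] := eqVneq j' j; last by rewrite nth_table_of !andbF.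
by rewrite /slide !nth_set_nth /= nth_set_nth /= !nth_table_of !andbT.
Qed.

(** One direction lifts explicit walks on tables to grave diagrams, the other sends sequences of
    moves to paths of tables. *)
Lemma moves_table_of E t :
  t \in moves n (table_of E) <-> exists2 F, GK_move E F & t = table_of F.
Proof.
split=> [/movesP[j0 [d [j0n /col_movesP[i0 [k0 [b [/andP[ki i0n] /andP[iS iR] kS rS [bP ->]]]]]]] ->]|].
  rewrite size_table_of in j0n; pose j := Ordinal j0n.
  rewrite -[j0]/(val j) size_column in i0n *.
  pose i := Ordinal i0n; pose k := Ordinal (ltn_trans ki i0n).
  have sP : slidable E i j k.
    apply/and5P; rewrite -!nth_table_of /=; split=> //.
      by apply/forallP => r; apply/implyP => kri; rewrite -nth_table_of rS.
    move: iR; rewrite -[i0]/(nat_of_ord i) -[j0]/(nat_of_ord j) nth_occupied_rows.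
    by rewrite negb_exists; under eq_forallb => j' do rewrite negb_and -implybE.
  exists (moved E i j k b); last by rewrite table_of_moved.
  by apply/GK_moveP; exists i, j, k, b.
case=> F /GK_moveP[i [j [k [b [sP bP ->]]]]] ->; rewrite table_of_moved //.
have /and5P[ki iS kS /forallP rS /forallP jS] := sP.
apply/movesP; exists j, (slide (nth [::] (table_of E) j) i k b).
split; rewrite ?size_table_of //; apply/col_movesP; exists i, k, b.
rewrite size_column ki ltn_ord !nth_table_of iS kS nth_occupied_rows; split=> //.
  by rewrite negb_exists; apply/forallP => j'; rewrite negb_and -implybE.
move=> r /andP[kr ri]; have rn := ltn_trans ri (ltn_ord i).
by rewrite -[r]/(val (Ordinal rn)) nth_table_of; apply/eqP/(implyP (rS _)); rewrite kr.
Qed.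
End Tables.

Lemma card_row n (A : {set cell n}) (i : 'I_n) :
  #|[set c in A | c.1 == i]| = count (fun j => (i, j) \in A) (enum 'I_n).
Proof.
rewrite -size_filter -(size_map (pair i)).
have /card_uniqP <- : uniq (map (pair i) [seq j <- enum 'I_n | (i, j) \in A]).
  by rewrite map_inj_uniq => [|j j' []//]; apply/filter_uniq/enum_uniq.
apply: eq_card => -[i' j]; rewrite !inE; apply/andP/mapP => [[cA /eqP/= ii']|[j' + [-> ->]]].
  by exists j; rewrite -ii' // mem_filter ii' mem_enum -ii' cA.
by rewrite mem_filter => /andP[].
Qed.

Lemma row_wt_occ n (E : grave n) :
  row_wt (occ E) =
  mkseq (fun i => count (fun c => isSome (nth None c i)) (table_of E)) n :> seq nat.
Proof.
rewrite /mkseq -val_enum_ord -map_comp; apply: eq_map => i /=.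
rewrite card_row /table_of [RHS]count_map; apply: eq_count => j /=.
by rewrite -status_occ (nth_map i) ?size_enum_ord // nth_ord_enum.
Qed.

Lemma connect_path_tables n (E F : grave n) :
  connect (@GK_move n) E F ->
  exists2 p, path (step n) (table_of E) p & last (table_of E) p = table_of F.
Proof.
case/connectP => p pP ->; exists (map (@table_of n) p); last by rewrite last_map.
rewrite path_map; apply: sub_path pP => G H GH.
by apply/orP; right; apply/moves_table_of; exists H.
Qed.

(* An index out of range leaves the table unchanged. *)
Definition walk (n : nat) : table -> seq nat -> table :=
  foldl (fun t k => nth t (moves n t) k).

Lemma connect_walk n (E : grave n) ks :
  exists2 F, connect (@GK_move n) E F & table_of F = walk n (table_of E) ks.
Proof.
elim: ks E => [|k ks IHks] E /=; first by exists E.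
have [ltk|lek] := ltnP k (size (moves n (table_of E))); last by rewrite nth_default.
have /moves_table_of[F EF ->] := mem_nth (table_of E) ltk.
by have [G FG <-] := IHks F; exists G => //; apply: connect_trans FG; apply: connect1.
Qed.

(** * The grave diagrams for [u] and [beta] *)

Local Notation N := (None : option bool).
Local Notation B := (Some true).
Local Notation G := (Some false).

Definition rothe_u : table :=
  [:: nseq 9 N; nseq 9 N; nseq 9 N;
      [:: N; N; N; B; B; B; B; N; N];
      [:: N; N; N; B; B; N; N; N; N];
      [:: N; N; N; B; N; N; N; N; N];
      nseq 9 N;
      [:: N; N; N; N; N; N; B; N; N];
      nseq 9 N].

Definition final1 : table :=
  [:: nseq 9 N; nseq 9 N; nseq 9 N;
      [:: B; B; B; B; G; N; N; N; N];
      [:: B; G; G; B; N; N; N; N; N];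
      [:: B; G; G; G; N; N; N; N; N];
      nseq 9 N;
      [:: B; G; G; G; N; N; N; N; N];
      nseq 9 N].

Definition final2 : table :=
  set_nth [::] final1 3 [:: B; G; B; B; B; N; N; N; N].

Lemma table_rothe_u : table_of (rothe_grave u) = rothe_u.
Proof.
have uE (i : 'I_9) : (val (u i)).+1 = nth 0 u_word i by rewrite permE u_funS.
have uVE (j : 'I_9) : val ((u^-1)%g j) = index j.+1 u_word.
  by rewrite -[j in RHS](permKV u) uE index_uniq.
pose f (j i : nat) := if (i < index j.+1 u_word) && (j.+1 < nth 0 u_word i) then B else N.
transitivity (mkseq (fun j => mkseq (f j) 9) 9); last by [].
rewrite /table_of /mkseq -val_enum_ord -map_comp; apply: eq_map => j /=.
rewrite -map_comp; apply: eq_map => i /=.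
by rewrite /f /status !inE /= uVE -uE ltnS.
Qed.

(** One bit for each column from index 3 on; [false] marks the empty columns 6 and 8. *)
Definition shapes_u : bitseq := [:: true; true; true; false; true; false].

(** The weight 1 of the row of index 4, which [has_shape] leaves free, enters here. *)
Definition candidate_u (t : table) : bool :=
  (count (fun c => isSome (nth None c 4)) t == 1) ==>
  (t \in [:: drop 3 final1; drop 3 final2]).

Lemma explore_rothe_u :
  if explore 9 shapes_u (drop 3 rothe_u) is Some (_, fin) then all candidate_u fin else false.
Proof. by vm_compute. Qed.

Lemma path_rothe_u p :
  path (step 9) (drop 3 rothe_u) p -> all2 has_shape shapes_u (last (drop 3 rothe_u) p) ->
  candidate_u (last (drop 3 rothe_u) p).
Proof. exact: (@explore_last 9 shapes_u (drop 3 rothe_u) candidate_u explore_rothe_u p). Qed.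

(** Each number selects a move from the list [moves] of the current table; the walk witnesses that
    [final1] is reachable. *)
Lemma walk_final1 :
  walk 9 rothe_u [:: 2; 5; 5; 5; 5; 5; 4; 2; 2; 0; 0; 1; 1; 1; 1] = final1.
Proof. by vm_compute. Qed.

Lemma walk_final2 :
  walk 9 rothe_u [:: 2; 8; 2; 6; 0; 1; 1; 1; 1; 1; 1; 0; 1; 1; 1] = final2.
Proof. by vm_compute. Qed.

Lemma mem_GKKoh_wt_u E :
  (E \in GKKoh_wt u beta) = (table_of E \in [:: final1; final2]).
Proof.
rewrite inE [E \in GKKoh u]inE; apply/andP/idP => [[uE /eqP wtE]|tE]; last first.
  split; last first.
    apply/eqP/val_inj; rewrite /= row_wt_occ.
    by move: tE; rewrite !inE => /pred2P[] ->.
  have reach ks : table_of E = walk 9 rothe_u ks -> connect (@GK_move 9) (rothe_grave u) E.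
    have [F uF tF] := connect_walk (rothe_grave u) ks.
    by rewrite -table_rothe_u -tF => /table_of_inj->.
  by move: tE; rewrite !inE -walk_final1 -walk_final2 => /pred2P[]; apply: reach.
have [p] := connect_path_tables uE; rewrite table_rothe_u => pP lastp.
have emptyE j : j \in [:: 0; 1; 2; 6; 8] -> nth [::] (table_of E) j = nseq 9 N.
  move=> jP; rewrite -lastp (path_empty_column pP);
    by move: jP; rewrite !inE => /or4P[|||/orP[]] /eqP->.
have : row_wt (occ E) = [:: 4; 4; 4; 4; 1; 0; 0; 0; 0] :> seq nat by rewrite wtE.
rewrite row_wt_occ; move: lastp emptyE (size_table_of E).
case: (table_of E) => [|c0 [|c1 [|c2 [|c3 [|c4 [|c5 [|c6 [|c7 [|c8 [|]]]]]]]]]] // lastp emptyE _.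
have e0 : c0 = nseq 9 N := emptyE 0 isT.
have e1 : c1 = nseq 9 N := emptyE 1 isT.
have e2 : c2 = nseq 9 N := emptyE 2 isT.
have e6 : c6 = nseq 9 N := emptyE 6 isT.
have e8 : c8 = nseq 9 N := emptyE 8 isT.
subst c0 c1 c2 c6 c8.
move=> wt; have sumE i : i < 9 -> isSome (nth N c3 i) + isSome (nth N c4 i) +
    isSome (nth N c5 i) + isSome (nth N c7 i) = nth 0 [:: 4; 4; 4; 4; 1; 0; 0; 0; 0] i.
  move=> i9; rewrite -wt nth_mkseq //.
  have : nth N (nseq 9 N) i = N by rewrite nth_nseq if_same.
  (* The empty column becomes a variable, so that simplification leaves [nth N e i] in place for
     [eN]. *)
  by move: (nseq 9 N) => e eN; rewrite /= eN /= !add0n !addn0 !addnA.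
have shapeE : all2 has_shape shapes_u [:: c3; c4; c5; nseq 9 N; c7; nseq 9 N].
  have full i : i \in iota 0 4 -> [&& isSome (nth N c3 i), isSome (nth N c4 i),
      isSome (nth N c5 i) & isSome (nth N c7 i)].
    rewrite mem_iota => /andP[_ i4]; have := sumE i (@leq_trans 4 _ 9 i4 isT).
    have -> : nth 0 [:: 4; 4; 4; 4; 1; 0; 0; 0; 0] i = 4 by move: i4; case: i => [|[|[|[|]]]].
    by do 4!case: isSome.
  have empty i : i \in iota 5 4 -> [&& ~~ isSome (nth N c3 i), ~~ isSome (nth N c4 i),
      ~~ isSome (nth N c5 i) & ~~ isSome (nth N c7 i)].
    rewrite mem_iota => /andP[i5 i9]; have := sumE i i9.
    have -> : nth 0 [:: 4; 4; 4; 4; 1; 0; 0; 0; 0] i = 0.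
      by move: i5 i9; do 9?[case: i => [|i] //].
    by do 4!case: isSome.
  have colP c : (forall i, i \in iota 0 4 -> isSome (nth N c i)) ->
      (forall i, i \in iota 5 4 -> ~~ isSome (nth N c i)) -> has_shape true c.
    by move=> fc ec; apply/andP; split; apply/allP => i iP; [rewrite fc | apply: ec].
  rewrite -[all2 _ _ _]/[&& has_shape true c3, has_shape true c4, has_shape true c5,
    has_shape false (nseq 9 N), has_shape true c7, has_shape false (nseq 9 N) & true].
  by rewrite !colP => // i; (move/full/and4P || move/empty/and4P) => -[].
have [q qP lastq] : exists2 q, path (step 9) (drop 3 rothe_u) q &
    last (drop 3 rothe_u) q = [:: c3; c4; c5; nseq 9 N; c7; nseq 9 N].
  (* The three empty columns on the left do not influence the moves in the other six. *)
  have bP := path_behead (path_behead (path_behead pP)).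
  exists (map behead (map behead (map behead p))); first exact bP.
  have lastb s p' : last (behead s) (map behead p') = behead (last s p') by rewrite last_map.
  by rewrite -[drop 3 _]/(behead (behead (behead rothe_u))) !lastb lastp.
have := path_rothe_u qP; rewrite lastq => /(_ shapeE)/implyP tP.
have tailP : [:: c3; c4; c5; nseq 9 N; c7; nseq 9 N] \in [:: drop 3 final1; drop 3 final2].
  by apply: tP; rewrite /= !add0n !addn0 !addnA (sumE 4).
(* Both final tables begin with the same three empty columns. *)
have -> t : [:: nseq 9 N, nseq 9 N, nseq 9 N & t] = take 3 final1 ++ t by [].
by move: tailP; rewrite !inE => /pred2P[] ->; rewrite eqxx ?orbT.
Qed.

Lemma card_GKKoh_wt_u : #|GKKoh_wt u beta| = 2.
Proof.
have [E1 uE1] := connect_walk (rothe_grave u) [:: 2; 5; 5; 5; 5; 5; 4; 2; 2; 0; 0; 1; 1; 1; 1].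
have [E2 uE2] := connect_walk (rothe_grave u) [:: 2; 8; 2; 6; 0; 1; 1; 1; 1; 1; 1; 0; 1; 1; 1].
rewrite table_rothe_u walk_final1 walk_final2 => tE2 tE1.
have -> : GKKoh_wt u beta = [set E1; E2].
  apply/setP => E; rewrite mem_GKKoh_wt_u -tE1 -tE2 !inE.
  by rewrite !(inj_eq (@table_of_inj _)).
by rewrite cards2 -(inj_eq (@table_of_inj _)) tE1 tE2.
Qed.

(** * Enumeration of pipe dreams row by row *)

Fixpoint bitseqs (m k : nat) : seq bitseq :=
  if m is m'.+1 then
    map (cons false) (bitseqs m' k) ++
    (if k is k'.+1 then map (cons true) (bitseqs m' k') else [::])
  else if k is 0 then [:: [::]] else [::].

Lemma mem_bitseqs m k r : (r \in bitseqs m k) = (size r == m) && (count id r == k).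
Proof.
elim: m k r => [|m IHm] [|k] [|b r] //=; rewrite mem_cat ?in_nil ?orbF.
- by apply/idP; case/mapP.
- case: b; first by rewrite andbF; apply/idP; case/mapP.
  by rewrite mem_map ?IHm // => ? ? [].
- by apply/idP; case/orP; case/mapP.
rewrite eqSS; case: b => /=.
  rewrite (mem_map (f := cons true)) ?IHm => [|? ? [] //]; rewrite eqSS.
  by rewrite (_ : _ \in _ = false) //; apply/idP; case/mapP.
rewrite (mem_map (f := cons false)) ?IHm => [|? ? [] //].
by rewrite (_ : _ \in map (cons true) _ = false) ?orbF //; apply/idP; case/mapP.
Qed.

(* The rows of crossings, counted by [ks], whose pipes leave on the left with the
   labels [us]; row [r] has one tile less than there are pipes entering it from the
   top, the half-bump being omitted. *)
Fixpoint fillings (us ks tops : seq nat) (X : crossed) : seq (seq bitseq) :=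
  match us, ks with
  | [::], [::] => [:: [::]]
  | u :: us', k :: ks' =>
      flatten [seq let: (l, bots, X1) := trace_row (nth false r) 0 tops X in
                   if l == u then map (cons r) (fillings us' ks' bots X1) else [::]
              | r <- bitseqs (size tops).-1 k]
  | _, _ => [::]
  end.

Fixpoint fits (us ks tops : seq nat) (X : crossed) (rs : seq bitseq) : bool :=
  match us, ks, rs with
  | [::], [::], [::] => true
  | u :: us', k :: ks', r :: rs' =>
      [&& size r == (size tops).-1, count id r == k &
       let: (l, bots, X1) := trace_row (nth false r) 0 tops X in
       (l == u) && fits us' ks' bots X1 rs']
  | _, _, _ => false
  end.

Lemma mem_fillings us ks tops X rs :
  (rs \in fillings us ks tops X) = fits us ks tops X rs.
Proof.
elim: us ks tops X rs => [|u us IHus] [|k ks] tops X [|r rs] //=.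
  by apply/flatten_mapP => -[r _]; case: trace_row => [[l bots] X1]; case: eqP => // _ /mapP[].
rewrite andbA -mem_bitseqs; apply/flatten_mapP/andP => [[r' r'P]|[rP]].
  case Er: trace_row => [[l bots] X1]; case: eqP => // lu.
  by case/mapP => rs' rsP [-> ->]; rewrite r'P Er lu eqxx -IHus.
case Er: trace_row => [[l bots] X1] /andP[lu rsP]; exists r => //.
by rewrite Er lu; apply/map_f; rewrite IHus.
Qed.

(** The last pipe meets the half-bump, so one tile less than the number of pipes is read. This
    allows a finite row of bits to replace the crossing function. *)
Lemma eq_trace_row f g j tops X :
  (forall l, j <= l < j + (size tops).-1 -> f l = g l) ->
  trace_row f j tops X = trace_row g j tops X.
Proof.
elim: tops j => [|a [|b tops] IHtops] j // eqfg.
have fj : f j = g j by apply: eqfg; rewrite leqnn /= addnS ltnS leq_addr.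
have ft : trace_row f j.+1 (b :: tops) X = trace_row g j.+1 (b :: tops) X.
  by apply: IHtops => l /andP[jl lt]; apply: eqfg; rewrite (ltnW jl) /= addnS -addSn.
by rewrite /= -/(trace_row f j.+1 (b :: tops) X) ft fj.
Qed.

Lemma size_trace_row f j tops X : size (trace_row f j tops X).1.2 = (size tops).-1.
Proof.
elim: tops j => [|a [|b tops] IHtops] j //.
rewrite /= -/(trace_row f j.+1 (b :: tops) X); have := IHtops j.+1.
case: (trace_row f j.+1 (b :: tops) X) => [[l bots] X1] /= sz.
by case: trace_tile => [[? ?] ?] /=; rewrite sz.
Qed.

Section PipeDreams.
Variable n : nat.
Implicit Types (P : {set cell n}) (w : 'S_n).

Definition cross_at P (i j : nat) : bool :=
  [exists c in P, (val c.1 == i) && (val c.2 == j)].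

Lemma cross_atE P (i j : 'I_n) : cross_at P i j = ((i, j) \in P).
Proof.
apply/exists_inP/idP => [[[i' j'] cP /andP[/eqP/val_inj <- /eqP/val_inj <-]] //|ijP].
by exists (i, j); rewrite ?eqxx.
Qed.

Definition pd_rows P : seq bitseq := mkseq (fun i => mkseq (cross_at P i) (n - i.+1)) n.

Definition pd_of (rs : seq bitseq) : {set cell n} :=
  [set c : cell n | nth false (nth [::] rs c.1) c.2].

Lemma cross_at_staircase P i j : is_pipe_dream P -> cross_at P i j -> j < n - i.+1.
Proof.
move/subsetP=> Pst /exists_inP[c /Pst]; rewrite inE => cst /andP[/eqP <- /eqP <-].
by rewrite ltn_subRL addnC -addSn addnC.
Qed.

Lemma pd_of_pd_rows P : is_pipe_dream P -> pd_of (pd_rows P) = P.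
Proof.
move=> Pst; apply/setP => -[i j]; rewrite inE /= nth_mkseq //.
have [ltj|lej] := ltnP j (n - i.+1); first by rewrite nth_mkseq // cross_atE.
rewrite nth_default ?size_mkseq //; apply/esym/negbTE.
by apply: contraL lej; rewrite -cross_atE -ltnNge; apply: cross_at_staircase.
Qed.

(** Together with [pd_of_pd_rows], a bijection between pipe dreams and lists of rows with the
    staircase lengths. *)
Lemma shaped_pd_of rs :
  [seq size r | r <- rs] = mkseq (fun i => n - i.+1) n ->
  is_pipe_dream (pd_of rs) /\ pd_rows (pd_of rs) = rs.
Proof.
move=> szrs; have sz : size rs = n by rewrite -(size_map size) szrs size_mkseq.
have szr i : i < n -> size (nth [::] rs i) = n - i.+1.
  by move=> ltin; rewrite -(nth_map _ 0) ?sz // szrs nth_mkseq.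
split; first apply/subsetP => -[i j]; rewrite ?inE /=.
  by apply: contraLR; rewrite -ltnNge addnS ltnS => ltn; rewrite nth_default // szr // leq_subLR.
apply: (@eq_from_nth _ [::]); rewrite size_mkseq ?sz // => i ltin.
rewrite nth_mkseq //; apply: (@eq_from_nth _ false); rewrite size_mkseq ?szr // => j ltj.
have ltjn : j < n := leq_trans ltj (leq_subr _ _).
by rewrite nth_mkseq // (cross_atE _ (Ordinal ltin) (Ordinal ltjn)) inE.
Qed.

Lemma row_wt_pipe_dream P : is_pipe_dream P ->
  row_wt P = [seq count id r | r <- pd_rows P] :> seq nat.
Proof.
move=> Pst; rewrite /pd_rows /mkseq -map_comp -val_enum_ord -map_comp.
apply: eq_map => i /=; rewrite card_row count_map.
have -> : count (fun j => (i, j) \in P) (enum 'I_n) = count (cross_at P i) (iota 0 n).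
  by rewrite -val_enum_ord count_map; apply: eq_count => j /=; rewrite cross_atE.
(* The columns from [n - i.+1] on lie outside the staircase and contribute no crossing. *)
have -> : iota 0 n = iota 0 (n - i.+1) ++ iota (n - i.+1) i.+1.
  by rewrite -{2}[n - i.+1]add0n -iotaD subnK.
rewrite count_cat.
rewrite [X in _ + X](_ : _ = 0) ?addn0; first exact: eq_count.
apply/eqP; rewrite -leqn0 leqNgt -has_count; apply/hasPn => j.
by rewrite mem_iota => /andP[lej _]; apply: contraL lej; rewrite -ltnNge => /cross_at_staircase->.
Qed.

(** Separates the conditions on labels and on weights, which [fits] checks together in each row.
    Since one pipe leaves per row, [n - i] pipes enter row [i], which fixes the row lengths. *)
Lemma fits_rows (cross : nat -> nat -> bool) us ks i m tops X :
  i + m = n -> size tops = m ->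
  fits us ks tops X [seq mkseq (cross i') (n - i'.+1) | i' <- iota i m] =
  (trace_rows cross i m tops X == us) &&
  ([seq count id (mkseq (cross i') (n - i'.+1)) | i' <- iota i m] == ks).
Proof.
elim: m i us ks tops X => [|m IHm] i [|u us] [|k ks] tops X //= imn sz.
- by case: trace_row => [[]].
- by case: trace_row => [[]].
- by case: trace_row => [[? ?] ?]; rewrite andbC.
have szr : n - i.+1 = (size tops).-1 by rewrite -imn sz -addSnnS addKn.
rewrite size_mkseq szr eqxx /=.
rewrite (@eq_trace_row _ (cross i)) => [|l /andP[_ ltl]]; last by rewrite nth_mkseq.
have := size_trace_row (cross i) 0 tops X.
case: trace_row => [[l bots] X1] /= szb.
rewrite IHm ?addSnnS // ?szb ?sz // !eqseq_cons.
by case: (_ == k) => /=; rewrite ?andbF // andbA.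
Qed.

Lemma mem_PD_wt w (alpha : n.-tuple nat) P :
  (P \in PD_wt w alpha) =
  is_pipe_dream P && (pd_rows P \in fillings (one_line w) alpha (iota 1 n) [::]).
Proof.
rewrite !inE -andbA; case Pst: is_pipe_dream => //=.
rewrite mem_fillings /pd_rows /mkseq fits_rows ?size_iota //; congr (_ && _).
by rewrite -val_eqE /= (row_wt_pipe_dream Pst) /pd_rows /mkseq -map_comp.
Qed.

(** The staircase lengths make [pd_of] injective on [fs]. Both hypotheses are decidable and get
    settled by evaluation for a concrete [w]. *)
Lemma card_PD_wt w (alpha : n.-tuple nat) :
  let fs := fillings (one_line w) alpha (iota 1 n) [::] in
  uniq fs -> all (fun rs => [seq size r | r <- rs] == mkseq (fun i => n - i.+1) n) fs ->
  #|PD_wt w alpha| = size fs.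
Proof.
move=> fs ufs /allP fsP; rewrite -(size_map pd_of).
have pdK : {in fs, cancel pd_of pd_rows} by move=> rs /fsP/eqP/shaped_pd_of[].
have /card_uniqP <- : uniq (map pd_of fs).
  by rewrite map_inj_in_uniq //; apply: can_in_inj pdK.
apply: eq_card => P; rewrite mem_PD_wt; apply/andP/mapP => [[Pst Pfs]|[rs rsfs ->]].
  by exists (pd_rows P); rewrite ?pd_of_pd_rows.
by rewrite pdK //; split=> //; have /eqP/shaped_pd_of[] := fsP _ rsfs.
Qed.

End PipeDreams.

Lemma fillings_u :
  let fs := fillings [:: 1; 2; 3; 7; 6; 5; 9; 4; 8] beta (iota 1 9) [::] in
  [&& uniq fs, all (fun rs => [seq size r | r <- rs] == mkseq (fun i => 9 - i.+1) 9) fs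
    & size fs == 3].
Proof. by vm_compute. Qed.

Theorem proposition3p9 :
  #|GKKoh_wt u beta| = 2 /\ #|PD_wt u beta| = 3.
Proof.
split; first exact: card_GKKoh_wt_u.
have /and3P[ufs fsP /eqP fs3] := fillings_u.
by rewrite card_PD_wt u_one_line.
Qed.
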